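(* Let $P$ be a poset and let $\alpha>0$ be a countable limit ordinal. If $I(P^{<\alpha})$ is wqo, then $P^\alpha$ and $P^{<\alpha}$ are wqo.
   Context: A poset is wqo if it has no infinite antichain and no infinite strictly decreasing sequence. For a poset $P$ and ordinal $\alpha$, $P^\alpha$ is the poset obtained by factoring the quasi-order on the set of all $\alpha$-sequences from $P$ given by $s\le t$ iff there is a strictly increasing $\rho:\alpha\to\alpha$ with $s(\gamma)\le_P t(\rho(\gamma))$ for all $\gamma<\alpha$ (factoring by mutual $\le$). $P^{<\alpha}$ is defined similarly on all sequences of length $<\alpha$ from $P$, with $s\le t$ iff there is a strictly increasing $\rho:\mathrm{dom}(s)\to\mathrm{dom}(t)$ with $s(\gamma)\le_P t(\rho(\gamma))$ for all $\gamma\in\mathrm{dom}(s)$. For a poset $Q$, $I(Q)$ is the set of initial segments (downward closed subsets) of $Q$ ordered by inclusion. *)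

(* Defs.v *)
From HB Require Import structures.
From mathcomp Require Import all_boot all_order.
From mathcomp Require Import all_classical.
From mathcomp Require Import wochoice.

Set Implicit Arguments.
Unset Strict Implicit.
Unset Printing Implicit Defensive.

Import Order.Theory.
Local Open Scope classical_set_scope.
Local Open Scope order_scope.

Section WQO.
Context {d : Order.disp_t} (Q : porderType d).

Definition antichain (X : set Q) : Prop :=
  forall x y, X x -> X y -> x != y -> x >< y.

Definition wqo : Prop :=
  ~ (exists2 X : set Q, infinite_set X & antichain X) /\
  ~ (exists s : nat -> Q, forall n, s n.+1 < s n).

End WQO.

(* The poset obtained from a quasi-order by identifying x and y whenever
   x <= y and y <= x. *)
Section Factor.
Context {d : Order.disp_t} (T : preorderType d).

Definition mutual_le (x y : T) : bool := (x <= y) && (y <= x).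

Lemma mutual_le_refl : reflexive mutual_le.
Proof. by move=> x; rewrite /mutual_le lexx. Qed.

Lemma mutual_le_sym : symmetric mutual_le.
Proof. by move=> x y; rewrite /mutual_le andbC. Qed.

Lemma mutual_le_trans : transitive mutual_le.
Proof.
move=> y x z /andP[xy yx] /andP[yz zy].
by rewrite /mutual_le (le_trans xy yz) (le_trans zy yx).
Qed.

Canonical mutual_le_equiv :=
  EquivRel mutual_le mutual_le_refl mutual_le_sym mutual_le_trans.

Definition factor : Type := {eq_quot mutual_le}%qT.

HB.instance Definition _ := Choice.on factor.
HB.instance Definition _ := EqQuotient.on factor.

Definition factor_le (u v : factor) : bool := repr u <= repr v.

Lemma factor_le_refl : reflexive factor_le.
Proof. by move=> u; rewrite /factor_le lexx. Qed.

Lemma factor_le_anti : antisymmetric factor_le.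
Proof.
move=> u v uv; rewrite -[u]reprK -[v]reprK.
by apply/eqmodP.
Qed.

Lemma factor_le_trans : transitive factor_le.
Proof. by move=> v u w; exact: le_trans. Qed.

HB.instance Definition _ := Order.Le_isPOrder.Build d factor
  factor_le_refl factor_le_anti factor_le_trans.

Lemma pi_le (x y : T) : ((\pi_factor x)%qT <= (\pi_factor y)%qT) = (x <= y).
Proof.
have reprP z : mutual_le (repr (\pi_factor z)%qT) z.
  by apply/eqmodP; rewrite reprK.
case/andP: (reprP x) => x1 x2; case/andP: (reprP y) => y1 y2.
rewrite -[LHS]/(repr _ <= repr _); apply/idP/idP => h.
  exact: le_trans x2 (le_trans h y1).
exact: le_trans x1 (le_trans h y2).
Qed.

End Factor.

(* An ordinal alpha is represented by a well-ordered type A of order type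
   alpha.  The ordinals beta < alpha are then the order types of the proper
   initial segments below b of A, each for exactly one b : A. *)
Definition below {d : Order.disp_t} (A : orderType d) (b : A) : Type :=
  {x : A | x < b}.

(* alpha is a nonzero limit ordinal when A is nonempty and has no maximum. *)
Definition limit_ordinal {d : Order.disp_t} (A : orderType d) : Prop :=
  [/\ well_order (<=%O : rel A), (exists x : A, True) &
      forall x : A, exists y : A, x < y].

Section Sequences.
Context {dP dA : Order.disp_t} (P : porderType dP) (A : orderType dA).

(* Aliases, since the function type A -> P already carries the pointwise
   order. *)
Definition full_seq : Type := A -> P.
Definition short_seq : Type := {b : A & below b -> P}.

HB.instance Definition _ := Choice.copy full_seq (A -> P).
HB.instance Definition _ := Choice.copy short_seq {b : A & below b -> P}.

Definition full_seq_le (s t : full_seq) : bool :=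
  `[< exists2 rho : A -> A, {homo rho : x y / x < y} &
        forall x, s x <= t (rho x) >].

Definition short_seq_le (s t : short_seq) : bool :=
  `[< exists2 rho : below (tag s) -> below (tag t),
        forall x y, val x < val y -> val (rho x) < val (rho y) &
        forall x, tagged s x <= tagged t (rho x) >].

Lemma full_seq_le_refl : reflexive full_seq_le.
Proof. by move=> s; apply/asboolP; exists id. Qed.

Lemma full_seq_le_trans : transitive full_seq_le.
Proof.
move=> t s u /asboolP[f fm fP] /asboolP[g gm gP]; apply/asboolP.
exists (g \o f) => [x y xy|x]; first exact/gm/fm.
exact: le_trans (fP x) (gP _).
Qed.

Lemma short_seq_le_refl : reflexive short_seq_le.
Proof. by move=> s; apply/asboolP; exists id. Qed.

Lemma short_seq_le_trans : transitive short_seq_le.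
Proof.
move=> t s u /asboolP[f fm fP] /asboolP[g gm gP]; apply/asboolP.
exists (g \o f) => [x y xy|x]; first exact/gm/fm.
exact: le_trans (fP x) (gP _).
Qed.

HB.instance Definition _ := Order.Le_isPreorder.Build dP full_seq
  full_seq_le_refl full_seq_le_trans.
HB.instance Definition _ := Order.Le_isPreorder.Build dP short_seq
  short_seq_le_refl short_seq_le_trans.

(* P^alpha *)
Definition seq_pow : porderType dP := factor full_seq.
(* P^{<alpha} *)
Definition seq_pow_lt : porderType dP := factor short_seq.

End Sequences.

Section InitialSegments.
Context {d : Order.disp_t} (Q : porderType d).

Definition initial_segment (I : set Q) : Prop :=
  forall x y, x <= y -> I y -> I x.

Record init_seg : Type := InitSeg {
  init_seg_set :> set Q;
  init_segP : `[< initial_segment init_seg_set >] }.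

HB.instance Definition _ := [isSub for init_seg_set].
HB.instance Definition _ := [Choice of init_seg by <:].
(* Inherits inclusion, the order of [set Q]. *)
HB.instance Definition _ :=
  [SubChoice_isSubPOrder of init_seg by <: with set_display].

End InitialSegments.

(* Main.v *)
Require Import Defs.
From mathcomp Require Import all_boot all_order.
From mathcomp Require Import all_classical.
From mathcomp Require Import wochoice.
Local Open Scope classical_set_scope.

(** An alpha-sequence s is determined up to equivalence by the set of short
    sequences that embed into it: if every proper initial segment of s embeds
    into t, then so does s, since the leftmost embeddings of the initial
    segments of s into t extend each other.  Hence P^alpha order-embeds into
    I(P^{<alpha}), while P^{<alpha} does so through its principal initial
    segments. *)

Set Implicit Arguments.
Unset Strict Implicit.
Unset Printing Implicit Defensive.

Import Order.Theory.
Local Open Scope order_scope.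

(** Preserving and reflecting the order makes [f] injective, so infinite antichains and strictly
    decreasing sequences of [Q] are carried to ones of [Q']. *)
Lemma wqo_order_embedding (d d' : Order.disp_t) (Q : porderType d)
    (Q' : porderType d') (f : Q -> Q') :
  (forall x y, (f x <= f y) = (x <= y)) -> wqo Q' -> wqo Q.
Proof.
move=> f_le [noanti nodesc].
have f_inj : injective f by move=> x y e; apply/le_anti; rewrite -!f_le e lexx.
split.
  case=> X Xinf Xanti; apply: noanti; exists (f @` X).
    by apply: contra_not Xinf; rewrite (eq_finite_set (inj_card_eq (in2W f_inj))).
  move=> _ _ [x Xx <-] [y Xy <-] fxy.
  rewrite /Order.comparable !f_le; apply: Xanti => //.
  by apply: contra_neq fxy => ->.
case=> s sdec; apply: nodesc; exists (f \o s) => n.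
by rewrite lt_leAnge /= !f_le -lt_leAnge.
Qed.

Lemma init_seg_leP (d : Order.disp_t) (Q : porderType d) (I J : init_seg Q) :
  reflect ((I : set Q) `<=` J) (I <= J).
Proof. by rewrite leEsub; exact: subsetPset. Qed.

Definition principal (d : Order.disp_t) (Q : porderType d) (q : Q) :
  init_seg Q.
Proof.
exists [set x | x <= q]; apply/asboolP => x y xy; exact: le_trans xy.
Defined.

Lemma principal_le (d : Order.disp_t) (Q : porderType d) (p q : Q) :
  (principal p <= principal q) = (p <= q).
Proof.
apply/init_seg_leP/idP => [h|pq x]; first exact/h/lexx.
by move=> xp; exact: le_trans xp pq.
Qed.

Lemma well_order_min (d : Order.disp_t) (A : orderType d) (X : set A) :
  well_order (<=%O : rel A) -> X !=set0 ->
  exists2 m, X m & forall x, X x -> m <= x.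
Proof.
move=> woA [x Xx].
have [|m [[mX mmin] _]] := woA [pred x | `[< X x >]].
  by exists x; exact/asboolP.
exists m; first exact/asboolP.
by move=> y Xy; apply: mmin; exact/asboolP.
Qed.

Section EmbeddingShortSequences.
Context {dP dA : Order.disp_t} (P : porderType dP) (A : orderType dA).

(** The map [f] is kept explicit because the leftmost embedding is built from values of individual
    embeddings. *)
Definition is_embedding (u : short_seq P A) (t : full_seq P A)
    (f : below (tag u) -> A) : Prop :=
  (forall x y, val x < val y -> f x < f y) /\
  (forall x, tagged u x <= t (f x)).

Definition embeds (u : short_seq P A) (t : full_seq P A) : Prop :=
  exists f, is_embedding t (u := u) f.

Definition restrict (s : full_seq P A) (b : A) : short_seq P A :=
  existT (fun b => below b -> P) b (s \o val).

Lemma restrict_embeds (s : full_seq P A) (b : A) : embeds (restrict s b) s.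
Proof. by exists val; split. Qed.

Lemma embeds_le_short (u v : short_seq P A) (t : full_seq P A) :
  u <= v -> embeds v t -> embeds u t.
Proof.
move=> /asboolP[r rm rP] [f [fm fP]]; exists (f \o r); split.
  by move=> x y /rm; exact: fm.
by move=> x; exact: le_trans (rP x) (fP _).
Qed.

Lemma embeds_le_full (u : short_seq P A) (s t : full_seq P A) :
  s <= t -> embeds u s -> embeds u t.
Proof.
move=> /asboolP[r rm rP] [f [fm fP]]; exists (r \o f); split.
  by move=> x y /fm; exact: rm.
by move=> x; exact: le_trans (fP x) (rP _).
Qed.

(* The leftmost embedding needs no recursion: it sends x to the least value at
   x of an embedding of an initial segment of s that contains x. *)
Lemma full_seq_le_restrict (s t : full_seq P A) :
  limit_ordinal A -> (forall b, embeds (restrict s b) t) -> s <= t.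
Proof.
move=> [woA _ limA] st.
pose vals x := [set y | exists b (xb : x < b) (f : below b -> A),
  is_embedding t (u := restrict s b) f /\ f (exist _ x xb) = y].
have vals0 x : vals x !=set0.
  have [b xb] := limA x; have [f fe] := st b.
  by exists (f (exist _ x xb)), b, xb, f.
have /choice[r rP] x : exists m, vals x m /\ forall y, vals x y -> m <= y.
  by have [m] := well_order_min woA (vals0 x); exists m.
apply/asboolP; exists r => [x y xy|x].
  (* The embedding [f] that attains the least value at [y] is also defined at [x], so
     [r x <= f x < f y = r y]. *)
  have [[b [yb [f [fe <-]]]] _] := rP y.
  have xb := lt_trans xy yb.
  apply: (@le_lt_trans _ _ (f (exist _ x xb))).
    by apply: (rP x).2; exists b, xb, f.
  exact: fe.1.
have [[b [xb [f [fe <-]]]] _] := rP x.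
exact: (fe.2 (exist _ x xb)).
Qed.

Definition short_below (s : seq_pow P A) : init_seg (seq_pow_lt P A).
Proof.
exists [set u : seq_pow_lt P A | embeds (repr u) (repr s)]%qT.
by apply/asboolP => u v uv; exact: embeds_le_short.
Defined.

Lemma short_below_le (s t : seq_pow P A) :
  limit_ordinal A -> (short_below s <= short_below t) = (s <= t).
Proof.
move=> limA; apply/init_seg_leP/idP => [st|st u]; last exact: embeds_le_full.
apply: full_seq_le_restrict => // b.
(* Members of [short_below s] are classes, and the representative of [u] is only equivalent to the
   restriction: [u1] places [u] in [short_below s], and [u2] brings the embedding into [repr t] back
   to the restriction. *)
pose u := (\pi_(Defs.factor (short_seq P A)) (restrict (repr s) b))%qT.
have /andP[u1 u2] : mutual_le (repr u) (restrict (repr s) b).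
  by apply/eqmodP; rewrite reprK.
apply: embeds_le_short u2 _; apply: (st u).
exact: embeds_le_short u1 (restrict_embeds _ _).
Qed.

End EmbeddingShortSequences.

Theorem mainTheorem4 (dP dA : Order.disp_t) (P : porderType dP)
    (A : orderType dA) :
  limit_ordinal A -> countable [set: A] ->
  wqo (init_seg (seq_pow_lt P A)) ->
  wqo (seq_pow P A) /\ wqo (seq_pow_lt P A).
Proof.
move=> limA _ wqoI; split.
  exact: wqo_order_embedding (fun s t => short_below_le s t limA) wqoI.
exact: wqo_order_embedding (@principal_le _ _) wqoI.
Qed.
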